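(* Let $F$ be a field in which $2$ is invertible, let $(V,B)$ be a formed space over $F$, and let $\iota\colon V\to K(V,B);\ v\mapsto I_B+v$ be the insertion into the Kingdon algebra. Suppose that $A$ is an alternative $F$-algebra, and that $\theta\colon V\to A;\ v\mapsto v'$ is a linear map such that $$u'v'+v'u'=B(u,v)\cdot 1\quad\text{and}\quad (u'v')w'=w'(v'u')$$ for all elements $u,v,w$ of $V$. Then there exists a unique $F$-algebra homomorphism $\Theta\colon K(V,B)\to A$ such that $\Theta(\iota(v))=\theta(v)$ for all $v\in V$.
   Context: Algebras over $F$ are unital but not necessarily associative, and homomorphisms preserve the unit. A formed space $(V,B)$ is a finite-dimensional $F$-vector space $V$ with a symmetric bilinear form $B$. An algebra is alternative if $x(xy)=(xx)y$ and $y(xx)=(yx)x$ for all elements $x,y$. $\mathrm{Alt}[V]$ denotes the free (unital) alternative $F$-algebra over $V$: it is alternative, contains $V$ as a subspace and $F=F1$, and each linear map from $V$ to an alternative $F$-algebra extends uniquely to an $F$-algebra homomorphism on $\mathrm{Alt}[V]$. The Kingdon algebra is $K(V,B)=\mathrm{Alt}[V]/I_B$, where $I_B$ is the two-sided ideal of $\mathrm{Alt}[V]$ generated by all elements $uv+vu-B(u,v)\cdot 1$ and $(uv)w-w(vu)$ with $u,v,w\in V$. *)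

(* Defs.v *)
From HB Require Import structures.
From mathcomp Require Import all_boot all_algebra.
From mathcomp Require Import boolp classical_sets.

Set Implicit Arguments.
Unset Strict Implicit.
Unset Printing Implicit Defensive.

Import GRing.Theory.
Local Open Scope ring_scope.
Local Open Scope quotient_scope.

(* Algebras are unital but not necessarily associative.
   The product and the unit are those of the library's unital magmas, written
   x * y and 1 in group_scope; the ring structures of ssralg do not apply, as
   they are all associative. *)
HB.mixin Record Lmodule_isNonAssocAlgebra (F : fieldType) A
    of GRing.Lmodule F A & UMagma A := {
  namul_linearl : forall y : A, linear (fun x : A => (x * y)%g);
  namul_linearr : forall x : A, linear (fun y : A => (x * y)%g)
}.

#[short(type="naAlgType")]
HB.structure Definition NonAssocAlgebra (F : fieldType) :=
  {A of GRing.Lmodule F A & UMagma A & Lmodule_isNonAssocAlgebra F A}.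

HB.mixin Record NonAssocAlgebra_isAlternative (F : fieldType) A
    of NonAssocAlgebra F A := {
  altmull : forall x y : A, (x * (x * y) = (x * x) * y)%g;
  altmulr : forall x y : A, (y * (x * x) = (y * x) * x)%g
}.

#[short(type="altAlgType")]
HB.structure Definition AltAlgebra (F : fieldType) :=
  {A of NonAssocAlgebra F A & NonAssocAlgebra_isAlternative F A}.

Notation "x ** y" := (x * y)%g (at level 40, left associativity) : ring_scope.

Definition alg_hom (F : fieldType) (A B : naAlgType F) (f : A -> B) : Prop :=
  [/\ linear f, f 1%g = 1%g & {morph f : x y / x ** y}].

Section NonAssocTheory.
Variables (F : fieldType) (A : naAlgType F).
Implicit Types (x y z : A) (a : F).

Lemma namulDl z x y : (x + y) ** z = x ** z + y ** z.
Proof. by have := namul_linearl z 1 x y; rewrite !scale1r. Qed.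

Lemma namulDr z x y : z ** (x + y) = z ** x + z ** y.
Proof. by have := namul_linearr z 1 x y; rewrite !scale1r. Qed.

Lemma namul0l z : 0 ** z = 0.
Proof. by apply: (addIr (0 ** z)); rewrite -namulDl !add0r. Qed.

Lemma namul0r z : z ** 0 = 0.
Proof. by apply: (addIr (z ** 0)); rewrite -namulDr !add0r. Qed.

Lemma namulZl a x y : (a *: x) ** y = a *: (x ** y).
Proof. by have := namul_linearl y a x 0; rewrite namul0l !addr0. Qed.

Lemma namulZr a x y : x ** (a *: y) = a *: (x ** y).
Proof. by have := namul_linearr x a y 0; rewrite namul0r !addr0. Qed.

Lemma namulNl x y : (- x) ** y = - (x ** y).
Proof. by rewrite -!scaleN1r namulZl. Qed.

Lemma namulNr x y : x ** (- y) = - (x ** y).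
Proof. by rewrite -!scaleN1r namulZr. Qed.

End NonAssocTheory.

HB.mixin Record isTwoSidedIdeal (F : fieldType) (A : naAlgType F)
    (I : A -> bool) := {
  ideal_scale : forall (a : F) x, x \in I -> a *: x \in I;
  ideal_mull : forall y x : A, x \in I -> y ** x \in I;
  ideal_mulr : forall y x : A, x \in I -> x ** y \in I
}.

#[short(type="algIdeal")]
HB.structure Definition AlgIdeal (F : fieldType) (A : naAlgType F) :=
  {I of GRing.ZmodClosed A I & isTwoSidedIdeal F A I}.

Section GeneratedIdeal.
Variables (F : fieldType) (A : naAlgType F) (S : set A).

Definition gen_ideal : {pred A} :=
  fun x => `[< forall I : algIdeal A, (forall y, S y -> y \in I) -> x \in I >].

Lemma gen_idealP x :
  reflect (forall I : algIdeal A, (forall y, S y -> y \in I) -> x \in I)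
          (x \in gen_ideal).
Proof. exact: asboolP. Qed.

Fact gen_ideal_zmod : zmod_closed gen_ideal.
Proof.
split=> [|x y /gen_idealP xI /gen_idealP yI]; apply/gen_idealP => I SI.
  exact: rpred0.
by rewrite rpredB ?xI ?yI.
Qed.

Fact gen_ideal_scale (a : F) x : x \in gen_ideal -> a *: x \in gen_ideal.
Proof.
by move=> /gen_idealP xI; apply/gen_idealP => I /xI; apply: ideal_scale.
Qed.

Fact gen_ideal_mull y x : x \in gen_ideal -> y ** x \in gen_ideal.
Proof.
by move=> /gen_idealP xI; apply/gen_idealP => I /xI; apply: ideal_mull.
Qed.

Fact gen_ideal_mulr y x : x \in gen_ideal -> x ** y \in gen_ideal.
Proof.
by move=> /gen_idealP xI; apply/gen_idealP => I /xI; apply: ideal_mulr.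
Qed.

HB.instance Definition _ := GRing.isZmodClosed.Build A gen_ideal gen_ideal_zmod.
HB.instance Definition _ := isTwoSidedIdeal.Build F A gen_ideal
  gen_ideal_scale gen_ideal_mull gen_ideal_mulr.

Lemma sub_gen_ideal y : S y -> y \in gen_ideal.
Proof. by move=> Sy; apply/gen_idealP => I; apply. Qed.

End GeneratedIdeal.

(* The underlying Z-module is the library quotient of a Z-module. *)
Section QuotientAlgebra.
Variables (F : fieldType) (A : naAlgType F) (I : algIdeal A).

Definition quot_alg := Quotient.quot I.
HB.instance Definition _ := GRing.Zmodule.on quot_alg.

Definition quot_pi (x : A) : quot_alg := \pi_(Quotient.quot I) x.

Lemma quot_pi_surj (P : quot_alg -> Prop) :
  (forall x, P (quot_pi x)) -> forall q, P q.
Proof. by move=> Ppi q; have := Ppi (repr q); rewrite /quot_pi reprK. Qed.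

Lemma quot_pi_eqP x y : quot_pi x = quot_pi y <-> x - y \in I.
Proof. by rewrite Quotient.idealrBE; split=> /eqP. Qed.

Lemma quot_piD x y : quot_pi (x + y) = quot_pi x + quot_pi y.
Proof. exact: (raddfD \pi_(Quotient.quot I)). Qed.

Definition quot_scale (a : F) (q : quot_alg) : quot_alg :=
  quot_pi (a *: repr q).
Definition quot_mul (p q : quot_alg) : quot_alg := quot_pi (repr p ** repr q).

Lemma quot_repr x : x - repr (quot_pi x) \in I.
Proof. by apply/quot_pi_eqP; rewrite /quot_pi reprK. Qed.

Lemma quot_scaleE a x : quot_scale a (quot_pi x) = quot_pi (a *: x).
Proof. by apply/esym/quot_pi_eqP; rewrite -scalerBr ideal_scale ?quot_repr. Qed.

Lemma quot_mulE x y : quot_mul (quot_pi x) (quot_pi y) = quot_pi (x ** y).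
Proof.
apply/esym/quot_pi_eqP; set x' := repr _; set y' := repr _.
have -> : x ** y - x' ** y' = (x - x') ** y + x' ** (y - y').
  by rewrite namulDl namulDr namulNl namulNr addrA subrK.
rewrite rpredD //.
  exact/ideal_mulr/quot_repr.
exact/ideal_mull/quot_repr.
Qed.

Fact quot_scaleA a b q : quot_scale a (quot_scale b q) = quot_scale (a * b) q.
Proof. by move: q; apply: quot_pi_surj => x; rewrite !quot_scaleE scalerA. Qed.
Fact quot_scale1 : left_id 1 quot_scale.
Proof. by apply: quot_pi_surj => x; rewrite quot_scaleE scale1r. Qed.
Fact quot_scaleDr : right_distributive quot_scale +%R.
Proof.
move=> a; apply: quot_pi_surj => x; apply: quot_pi_surj => y.
by rewrite -quot_piD !quot_scaleE -quot_piD scalerDr.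
Qed.
Fact quot_scaleDl q : {morph quot_scale^~ q : a b / a + b}.
Proof.
by move: q; apply: quot_pi_surj => x a b; rewrite !quot_scaleE scalerDl quot_piD.
Qed.
HB.instance Definition _ := GRing.Zmodule_isLmodule.Build F quot_alg
  quot_scaleA quot_scale1 quot_scaleDr quot_scaleDl.

HB.instance Definition _ := hasMul.Build quot_alg quot_mul.

Lemma quot_piM x y : quot_pi (x ** y) = quot_pi x ** quot_pi y.
Proof. by rewrite -quot_mulE. Qed.
Lemma quot_piZ a x : quot_pi (a *: x) = a *: quot_pi x.
Proof. by rewrite -quot_scaleE. Qed.

Fact quot_mul1l : left_id (quot_pi 1%g) (@monoid.mul quot_alg).
Proof. by apply: quot_pi_surj => x; rewrite -quot_piM monoid.mul1g. Qed.
Fact quot_mul1r : right_id (quot_pi 1%g) (@monoid.mul quot_alg).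
Proof. by apply: quot_pi_surj => x; rewrite -quot_piM monoid.mulg1. Qed.
HB.instance Definition _ := Magma_isUMagma.Build quot_alg quot_mul1l quot_mul1r.

Fact quot_linearl (r : quot_alg) : linear (fun p : quot_alg => p ** r).
Proof.
move=> a; move: r.
apply: quot_pi_surj => z; apply: quot_pi_surj => x; apply: quot_pi_surj => y.
by rewrite -!(quot_piZ, quot_piD, quot_piM) namulDl namulZl.
Qed.
Fact quot_linearr (r : quot_alg) : linear (fun p : quot_alg => r ** p).
Proof.
move=> a; move: r.
apply: quot_pi_surj => z; apply: quot_pi_surj => x; apply: quot_pi_surj => y.
by rewrite -!(quot_piZ, quot_piD, quot_piM) namulDr namulZr.
Qed.
HB.instance Definition _ := Lmodule_isNonAssocAlgebra.Build F quot_alg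
  quot_linearl quot_linearr.

Lemma quot_pi_hom : alg_hom quot_pi.
Proof.
split=> [a x y||x y] //; first by rewrite quot_piD quot_piZ.
exact: quot_piM.
Qed.

End QuotientAlgebra.

Section QuotientAlternative.
Variables (F : fieldType) (A : altAlgType F) (I : algIdeal A).

Fact quot_altl (p q : quot_alg I) : p ** (p ** q) = (p ** p) ** q.
Proof.
move: p q; apply: quot_pi_surj => x; apply: quot_pi_surj => y.
by rewrite -!quot_piM altmull.
Qed.
Fact quot_altr (p q : quot_alg I) : q ** (p ** p) = (q ** p) ** p.
Proof.
move: p q; apply: quot_pi_surj => x; apply: quot_pi_surj => y.
by rewrite -!quot_piM altmulr.
Qed.
HB.instance Definition _ := NonAssocAlgebra_isAlternative.Build F (quot_alg I)
  quot_altl quot_altr.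

End QuotientAlternative.

(* Alt[V] is built as the formal algebra expressions in the elements of V,
   modulo the congruence generated by the axioms of an alternative algebra and
   the linearity of V -> Alt[V]. That this is the free alternative algebra over
   V is proved below, in free_alt_univ and free_alt_inj. *)
Inductive alt_term (F V : Type) : Type :=
  | TVar of V
  | TZero
  | TOpp of alt_term F V
  | TAdd of alt_term F V & alt_term F V
  | TScale of F & alt_term F V
  | TOne
  | TMul of alt_term F V & alt_term F V.
Arguments TVar {F V}.
Arguments TZero {F V}.
Arguments TOne {F V}.

HB.instance Definition _ F V := gen_eqMixin (alt_term F V).
HB.instance Definition _ F V := gen_choiceMixin (alt_term F V).

Section FreeAlternative.
Variables (F : fieldType) (V : lmodType F).
Local Notation term := (alt_term F V).
Implicit Types (s t : term) (a b : F).

Inductive alt_cong : term -> term -> Prop :=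
  | cong_refl t : alt_cong t t
  | cong_sym s t : alt_cong s t -> alt_cong t s
  | cong_trans s t r : alt_cong s t -> alt_cong t r -> alt_cong s r
  | cong_opp s s' : alt_cong s s' -> alt_cong (TOpp s) (TOpp s')
  | cong_add s s' t t' : alt_cong s s' -> alt_cong t t' ->
      alt_cong (TAdd s t) (TAdd s' t')
  | cong_scale a s s' : alt_cong s s' -> alt_cong (TScale a s) (TScale a s')
  | cong_mul s s' t t' : alt_cong s s' -> alt_cong t t' ->
      alt_cong (TMul s t) (TMul s' t')
  | cong_addA s t r : alt_cong (TAdd s (TAdd t r)) (TAdd (TAdd s t) r)
  | cong_addC s t : alt_cong (TAdd s t) (TAdd t s)
  | cong_add0 t : alt_cong (TAdd TZero t) t
  | cong_addN t : alt_cong (TAdd (TOpp t) t) TZero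
  | cong_scaleA a b t : alt_cong (TScale a (TScale b t)) (TScale (a * b) t)
  | cong_scale1 t : alt_cong (TScale 1 t) t
  | cong_scaleDr a s t :
      alt_cong (TScale a (TAdd s t)) (TAdd (TScale a s) (TScale a t))
  | cong_scaleDl a b t :
      alt_cong (TScale (a + b) t) (TAdd (TScale a t) (TScale b t))
  | cong_mul1l t : alt_cong (TMul TOne t) t
  | cong_mul1r t : alt_cong (TMul t TOne) t
  | cong_linearl a s t r : alt_cong (TMul (TAdd (TScale a s) t) r)
                                    (TAdd (TScale a (TMul s r)) (TMul t r))
  | cong_linearr a s t r : alt_cong (TMul r (TAdd (TScale a s) t))
                                    (TAdd (TScale a (TMul r s)) (TMul r t))
  | cong_altl s t : alt_cong (TMul s (TMul s t)) (TMul (TMul s s) t)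
  | cong_altr s t : alt_cong (TMul t (TMul s s)) (TMul (TMul t s) s)
  | cong_var a (u v : V) :
      alt_cong (TVar (a *: u + v)) (TAdd (TScale a (TVar u)) (TVar v)).

Definition alt_rel s t : bool := `[< alt_cong s t >].

Fact alt_rel_equiv : equiv_class_of alt_rel.
Proof.
split=> [t|s t|t s r].
- exact/asboolP/cong_refl.
- by apply/asboolP/asboolP; apply: cong_sym.
- by move=> /asboolP st /asboolP tr; apply/asboolP/(cong_trans st).
Qed.

Canonical alt_equiv := EquivRelPack alt_rel_equiv.
Canonical alt_encModRel := defaultEncModRel alt_rel.

Definition free_alt := {eq_quot alt_rel}.
HB.instance Definition _ := Choice.on free_alt.

Definition free_pi t : free_alt := \pi_({eq_quot alt_rel}) t.

Lemma free_pi_surj (P : free_alt -> Prop) :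
  (forall t, P (free_pi t)) -> forall q, P q.
Proof. by move=> Ppi q; have := Ppi (repr q); rewrite /free_pi reprK. Qed.

Lemma free_pi_eqP s t : free_pi s = free_pi t <-> alt_cong s t.
Proof.
rewrite /free_pi; split=> [/eqP|st].
  by rewrite eqmodE => /asboolP.
by apply/eqP; rewrite eqmodE; apply/asboolP.
Qed.

Lemma free_repr t : alt_cong (repr (free_pi t)) t.
Proof. by apply/free_pi_eqP; rewrite /free_pi reprK. Qed.

Definition free_opp (p : free_alt) := free_pi (TOpp (repr p)).
Definition free_add (p q : free_alt) := free_pi (TAdd (repr p) (repr q)).
Definition free_scale a (p : free_alt) := free_pi (TScale a (repr p)).
Definition free_mul (p q : free_alt) := free_pi (TMul (repr p) (repr q)).

Lemma free_oppE t : free_opp (free_pi t) = free_pi (TOpp t).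
Proof. exact/free_pi_eqP/cong_opp/free_repr. Qed.
Lemma free_addE s t : free_add (free_pi s) (free_pi t) = free_pi (TAdd s t).
Proof. by apply/free_pi_eqP/cong_add; apply: free_repr. Qed.
Lemma free_scaleE a t : free_scale a (free_pi t) = free_pi (TScale a t).
Proof. exact/free_pi_eqP/cong_scale/free_repr. Qed.
Lemma free_mulE s t : free_mul (free_pi s) (free_pi t) = free_pi (TMul s t).
Proof. by apply/free_pi_eqP/cong_mul; apply: free_repr. Qed.

Let freeE := (free_oppE, free_addE, free_scaleE, free_mulE).

Fact free_addA : associative free_add.
Proof.
apply: free_pi_surj => s; apply: free_pi_surj => t; apply: free_pi_surj => r.
by rewrite !freeE; apply/free_pi_eqP/cong_addA.
Qed.
Fact free_addC : commutative free_add.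
Proof.
apply: free_pi_surj => s; apply: free_pi_surj => t.
by rewrite !freeE; apply/free_pi_eqP/cong_addC.
Qed.
Fact free_add0 : left_id (free_pi TZero) free_add.
Proof.
by apply: free_pi_surj => s; rewrite !freeE; apply/free_pi_eqP/cong_add0.
Qed.
Fact free_addN : left_inverse (free_pi TZero) free_opp free_add.
Proof.
by apply: free_pi_surj => s; rewrite !freeE; apply/free_pi_eqP/cong_addN.
Qed.
HB.instance Definition _ := GRing.isZmodule.Build free_alt
  free_addA free_addC free_add0 free_addN.

Fact free_scaleA a b p : free_scale a (free_scale b p) = free_scale (a * b) p.
Proof.
move: p; apply: free_pi_surj => s.
by rewrite !freeE; apply/free_pi_eqP/cong_scaleA.
Qed.
Fact free_scale1 : left_id 1 free_scale.
Proof.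
by apply: free_pi_surj => s; rewrite !freeE; apply/free_pi_eqP/cong_scale1.
Qed.
Fact free_scaleDr : right_distributive free_scale +%R.
Proof.
move=> a; apply: free_pi_surj => s; apply: free_pi_surj => t.
rewrite /GRing.add /= !freeE; exact/free_pi_eqP/cong_scaleDr.
Qed.
Fact free_scaleDl p : {morph free_scale^~ p : a b / a + b}.
Proof.
move: p; apply: free_pi_surj => s a b.
by rewrite [RHS]/GRing.add /= !freeE; apply/free_pi_eqP/cong_scaleDl.
Qed.
HB.instance Definition _ := GRing.Zmodule_isLmodule.Build F free_alt
  free_scaleA free_scale1 free_scaleDr free_scaleDl.

HB.instance Definition _ := hasMul.Build free_alt free_mul.

Lemma free_piN t : free_pi (TOpp t) = - free_pi t.
Proof. by rewrite -free_oppE. Qed.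
Lemma free_piD s t : free_pi (TAdd s t) = free_pi s + free_pi t.
Proof. by rewrite -free_addE. Qed.
Lemma free_piZ a t : free_pi (TScale a t) = a *: free_pi t.
Proof. by rewrite -free_scaleE. Qed.
Lemma free_piM s t : free_pi (TMul s t) = free_pi s ** free_pi t.
Proof. by rewrite -free_mulE. Qed.

Fact free_mul1l : left_id (free_pi TOne) (@monoid.mul free_alt).
Proof.
by apply: free_pi_surj => s; rewrite -free_piM; apply/free_pi_eqP/cong_mul1l.
Qed.
Fact free_mul1r : right_id (free_pi TOne) (@monoid.mul free_alt).
Proof.
by apply: free_pi_surj => s; rewrite -free_piM; apply/free_pi_eqP/cong_mul1r.
Qed.
HB.instance Definition _ := Magma_isUMagma.Build free_alt free_mul1l free_mul1r.

Fact free_linearl (r : free_alt) : linear (fun p : free_alt => p ** r).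
Proof.
move=> a; move: r.
apply: free_pi_surj => z; apply: free_pi_surj => s; apply: free_pi_surj => t.
rewrite -free_piZ -free_piD -!free_piM -free_piZ -free_piD.
exact/free_pi_eqP/cong_linearl.
Qed.
Fact free_linearr (r : free_alt) : linear (fun p : free_alt => r ** p).
Proof.
move=> a; move: r.
apply: free_pi_surj => z; apply: free_pi_surj => s; apply: free_pi_surj => t.
rewrite -free_piZ -free_piD -!free_piM -free_piZ -free_piD.
exact/free_pi_eqP/cong_linearr.
Qed.
HB.instance Definition _ := Lmodule_isNonAssocAlgebra.Build F free_alt
  free_linearl free_linearr.

Fact free_altl (p q : free_alt) : p ** (p ** q) = (p ** p) ** q.
Proof.
move: p q; apply: free_pi_surj => s; apply: free_pi_surj => t.
by rewrite -!free_piM; apply/free_pi_eqP/cong_altl.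
Qed.
Fact free_altr (p q : free_alt) : q ** (p ** p) = (q ** p) ** p.
Proof.
move: p q; apply: free_pi_surj => s; apply: free_pi_surj => t.
by rewrite -!free_piM; apply/free_pi_eqP/cong_altr.
Qed.
HB.instance Definition _ := NonAssocAlgebra_isAlternative.Build F free_alt
  free_altl free_altr.

Definition free_var (v : V) : free_alt := free_pi (TVar v).

Fact free_var_linear : linear free_var.
Proof.
by move=> a u v; rewrite -free_piZ -free_piD; apply/free_pi_eqP/cong_var.
Qed.
HB.instance Definition _ := GRing.isLinear.Build F V free_alt _ free_var
  free_var_linear.

Section Universal.
Variables (A : altAlgType F) (f : {linear V -> A}).

Fixpoint term_eval (t : term) : A :=
  match t with
  | TVar v => f v
  | TZero => 0
  | TOpp s => - term_eval s
  | TAdd s r => term_eval s + term_eval r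
  | TScale a s => a *: term_eval s
  | TOne => 1%g
  | TMul s r => term_eval s ** term_eval r
  end.

Lemma term_eval_cong s t : alt_cong s t -> term_eval s = term_eval t.
Proof.
elim=> {s t} //=.
- by move=> s t r _ -> _ ->.
- by move=> s s' _ ->.
- by move=> s s' t t' _ -> _ ->.
- by move=> a s s' _ ->.
- by move=> s s' t t' _ -> _ ->.
- by move=> s t r; rewrite addrA.
- by move=> s t; rewrite addrC.
- by move=> t; rewrite add0r.
- by move=> t; rewrite addNr.
- by move=> a b t; rewrite scalerA.
- by move=> t; rewrite scale1r.
- by move=> a s t; rewrite scalerDr.
- by move=> a b t; rewrite scalerDl.
- by move=> t; rewrite monoid.mul1g.
- by move=> t; rewrite monoid.mulg1.
- by move=> a s t r; rewrite namulDl namulZl.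
- by move=> a s t r; rewrite namulDr namulZr.
- by move=> s t; rewrite altmull.
- by move=> s t; rewrite altmulr.
- by move=> a u v; rewrite linearP.
Qed.

Definition free_lift (p : free_alt) : A := term_eval (repr p).

Lemma free_liftE t : free_lift (free_pi t) = term_eval t.
Proof. exact/term_eval_cong/free_repr. Qed.

Lemma free_lift_hom : alg_hom free_lift.
Proof.
split=> [a||]; last 1 first.
- apply: free_pi_surj => s; apply: free_pi_surj => t.
  by rewrite -free_piM !free_liftE.
- apply: free_pi_surj => s; apply: free_pi_surj => t.
  by rewrite -free_piZ -free_piD !free_liftE.
- exact: free_liftE.
Qed.

Lemma free_lift_var v : free_lift (free_var v) = f v.
Proof. exact: free_liftE. Qed.

Lemma free_lift_uniq (g : free_alt -> A) :
  alg_hom g -> (forall v, g (free_var v) = f v) -> g =1 free_lift.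
Proof.
case=> glin g1 gM gV; pose gL := GRing.isLinear.Build F _ _ _ g glin.
pose G : {linear free_alt -> A} := HB.pack g gL.
have gN : {morph g : x / - x} := raddfN G.
have gD : {morph g : x y / x + y} := raddfD G.
have gZ a : {morph g : x / a *: x} := linearZ_LR G a.
apply: free_pi_surj => t; rewrite free_liftE.
elim: t => [v||s IHs|s IHs t IHt|a s IHs||s IHs t IHt] /=.
- exact: gV.
- exact: (raddf0 G).
- by rewrite free_piN gN IHs.
- by rewrite free_piD gD IHs IHt.
- by rewrite free_piZ gZ IHs.
- exact: g1.
- by rewrite free_piM gM IHs IHt.
Qed.

Theorem free_alt_univ : exists! g : free_alt -> A,
  alg_hom g /\ forall v, g (free_var v) = f v.
Proof.
exists free_lift; split.
  by split; [exact: free_lift_hom|exact: free_lift_var].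
by move=> g [ghom gV]; apply/esym/funext/free_lift_uniq.
Qed.

End Universal.

End FreeAlternative.

(* The split-null extension F + V, with V * V = 0, separates the elements of
   F1 + V in Alt[V]. *)
Section SplitNull.
Variables (F : fieldType) (V : lmodType F).

Definition split_null : Type := (F^o * V)%type.
HB.instance Definition _ := GRing.Lmodule.on split_null.

Definition split_mul (x y : split_null) : split_null :=
  (x.1 * y.1, x.1 *: y.2 + y.1 *: x.2).
HB.instance Definition _ := hasMul.Build split_null split_mul.

Fact split_mul1l : left_id ((1, 0) : split_null) (@monoid.mul split_null).
Proof.
by case=> a u; congr pair; rewrite /= ?mul1r // scale1r scaler0 addr0.
Qed.
Fact split_mul1r : right_id ((1, 0) : split_null) (@monoid.mul split_null).
Proof.
by case=> a u; congr pair; rewrite /= ?mulr1 // scale1r scaler0 add0r.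
Qed.
HB.instance Definition _ :=
  Magma_isUMagma.Build split_null split_mul1l split_mul1r.

Lemma split_mulC (x y : split_null) : x ** y = y ** x.
Proof. by congr pair; rewrite /= ?[x.1 * _]mulrC // addrC. Qed.

Fact split_linearr (r : split_null) : linear (fun p : split_null => r ** p).
Proof.
move=> a x y; congr pair => /=.
  by rewrite mulrDr; congr (_ + _); apply: mulrCA.
rewrite -[a *: x.1 + y.1]/(a * x.1 + y.1) !scalerDr scalerDl !scalerA.
by rewrite [r.1 * a]mulrC addrACA.
Qed.
Fact split_linearl (r : split_null) : linear (fun p : split_null => p ** r).
Proof. by move=> a x y; rewrite ![_ ** r]split_mulC split_linearr. Qed.
HB.instance Definition _ := Lmodule_isNonAssocAlgebra.Build F split_null
  split_linearl split_linearr.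

Fact split_altl (x y : split_null) : x ** (x ** y) = (x ** x) ** y.
Proof.
congr pair => /=; first by rewrite mulrA.
by rewrite !(scalerDr, scalerA) addrA [y.1 * _]mulrC.
Qed.
Fact split_altr (x y : split_null) : y ** (x ** x) = (y ** x) ** x.
Proof. by rewrite split_mulC -split_altl split_mulC [x ** y]split_mulC. Qed.
HB.instance Definition _ := NonAssocAlgebra_isAlternative.Build F split_null
  split_altl split_altr.

Definition split_var (v : V) : split_null := (0, v).
Fact split_var_linear : linear split_var.
Proof. by move=> a u v; congr pair; rewrite /= scaler0 addr0. Qed.
HB.instance Definition _ := GRing.isLinear.Build F V split_null _ split_var
  split_var_linear.

End SplitNull.

Theorem free_alt_inj (F : fieldType) (V : lmodType F) (a b : F) (u v : V) :
  a *: (1%g : free_alt V) + free_var u = b *: 1%g + free_var v ->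
  a = b /\ u = v.
Proof.
pose h := free_lift (@split_var F V).
have [hlin h1 _] : alg_hom h := free_lift_hom _.
have hE c w : h (c *: 1%g + free_var w) = (c, w).
  rewrite hlin h1 [h _]free_lift_var; congr pair => /=.
    by rewrite addr0 [c *: _]mulr1.
  by rewrite scaler0 add0r.
by move/(congr1 h); rewrite !hE => -[].
Qed.

Section Kingdon.
Variables (F : fieldType) (V : vectType F) (B : {symmetric V}).
Local Notation "[[ v ]]" := (free_var v) (at level 0).

Definition kingdon_rel : set (free_alt V) := fun x =>
  (exists u v, x = [[u]] ** [[v]] + [[v]] ** [[u]] - B u v *: 1%g) \/
  (exists u v w, x = ([[u]] ** [[v]]) ** [[w]] - [[w]] ** ([[v]] ** [[u]])).

Definition kingdon := quot_alg (gen_ideal kingdon_rel).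
HB.instance Definition _ := AltAlgebra.on kingdon.

Definition kingdon_iota (v : V) : kingdon := quot_pi _ [[v]].

End Kingdon.

(* Main.v *)
(* The homomorphism Alt[V] -> A extending theta kills the generators of I_B, so
   its kernel, a two-sided ideal, contains I_B and it descends to K(V,B).
   Uniqueness is inherited from that of the extension to Alt[V], because the
   projection Alt[V] -> K(V,B) is surjective. *)
Require Import Defs.
From HB Require Import structures.
From mathcomp Require Import all_boot all_algebra.
From mathcomp Require Import boolp classical_sets.

Set Implicit Arguments.
Unset Strict Implicit.
Unset Printing Implicit Defensive.

Import GRing.Theory.
Local Open Scope ring_scope.

Section AlgHom.
Variables (F : fieldType) (A C : naAlgType F) (h : A -> C).
Hypothesis hom_h : alg_hom h.

(** [alg_hom] bundles no linear structure with [h], so this and the next rules are read off special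
    cases of the linearity equation; here [h 0 = h 0 + h 0] is cancelled. *)
Lemma alg_hom0 : h 0 = 0.
Proof.
case: hom_h => lin_h _ _; have := lin_h 1 0 0.
by rewrite !scale1r addr0 => h0; apply: (addrI (h 0)); rewrite addr0 -h0.
Qed.

Lemma alg_homZ a x : h (a *: x) = a *: h x.
Proof.
by case: hom_h => lin_h _ _; have := lin_h a x 0; rewrite !addr0 alg_hom0 addr0.
Qed.

Lemma alg_homD x y : h (x + y) = h x + h y.
Proof. by case: hom_h => lin_h _ _; have := lin_h 1 x y; rewrite !scale1r. Qed.

Lemma alg_homB x y : h (x - y) = h x - h y.
Proof. by rewrite alg_homD -scaleN1r alg_homZ scaleN1r. Qed.

Lemma alg_hom_comp (D : naAlgType F) (g : C -> D) :
  alg_hom g -> alg_hom (g \o h).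
Proof.
case: hom_h => lin_h h1 hM [lin_g g1 gM]; split=> [a x y||x y] /=.
- by rewrite lin_h lin_g.
- by rewrite h1.
- by rewrite hM gM.
Qed.

Definition hom_ker : {pred A} := fun x => h x == 0.

Fact hom_ker_zmod : zmod_closed hom_ker.
Proof.
split=> [|x y]; rewrite !unfold_in ?alg_hom0 // => /eqP hx /eqP hy.
by rewrite alg_homB hx hy subrr.
Qed.

Fact hom_ker_scale (a : F) x : x \in hom_ker -> a *: x \in hom_ker.
Proof. by rewrite !unfold_in alg_homZ => /eqP ->; rewrite scaler0. Qed.

Fact hom_ker_mull y x : x \in hom_ker -> y ** x \in hom_ker.
Proof.
by case: hom_h => _ _ hM; rewrite !unfold_in hM => /eqP ->; rewrite namul0r.
Qed.

Fact hom_ker_mulr y x : x \in hom_ker -> x ** y \in hom_ker.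
Proof.
by case: hom_h => _ _ hM; rewrite !unfold_in hM => /eqP ->; rewrite namul0l.
Qed.

Lemma gen_ideal_hom_ker (S : set A) :
  (forall x, S x -> h x = 0) -> forall x, x \in gen_ideal S -> h x = 0.
Proof.
move=> hS x /gen_idealP xI.
(* The closure properties of the kernel rest on [hom_h], so the ideal is packed locally; then [xI],
   which ranges over all ideals containing [S], is applied to it. *)
pose kerZ := GRing.isZmodClosed.Build A hom_ker hom_ker_zmod.
pose kerI := isTwoSidedIdeal.Build F A hom_ker
  hom_ker_scale hom_ker_mull hom_ker_mulr.
pose I : algIdeal A := HB.pack hom_ker kerZ kerI.
by apply/eqP/(xI I) => y Sy; apply/eqP/hS.
Qed.

End AlgHom.

Section QuotientLift.
Variables (F : fieldType) (A C : naAlgType F) (I : algIdeal A) (h : A -> C).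
Hypotheses (hom_h : alg_hom h) (hI : forall x, x \in I -> h x = 0).

(** Choosing a representative makes this a total function without any condition on [h]; independence
    of the choice is [quot_liftE]. *)
Definition quot_lift (q : quot_alg I) : C := h (repr q).

(** By [quot_repr], [x] and the chosen representative of its class differ by an element of [I],
    which [h] kills. *)
Lemma quot_liftE x : quot_lift (quot_pi I x) = h x.
Proof.
by apply/esym/eqP; rewrite -subr_eq0 -(alg_homB hom_h) hI ?quot_repr.
Qed.

Lemma quot_lift_hom : alg_hom quot_lift.
Proof.
case: hom_h => lin_h h1 hM; split=> [a||].
- apply: quot_pi_surj => x; apply: quot_pi_surj => y.
  by rewrite -quot_piZ -quot_piD !quot_liftE lin_h.
(* The unit of the quotient is by definition the class of the unit of [A]. *)
- by rewrite -h1; apply: quot_liftE.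
- apply: quot_pi_surj => x; apply: quot_pi_surj => y.
  by rewrite -quot_piM !quot_liftE hM.
Qed.

End QuotientLift.

Theorem proposition3p3 (F : fieldType) (hF : (2%:R : F) \is a GRing.unit)
    (V : vectType F) (B : {symmetric V})
    (A : altAlgType F) (theta : {linear V -> A})
    (htheta : forall u v : V,
       theta u ** theta v + theta v ** theta u = B u v *: (1%g : A))
    (htheta3 : forall u v w : V,
       (theta u ** theta v) ** theta w = theta w ** (theta v ** theta u)) :
  exists! Theta : kingdon B -> A,
    alg_hom Theta /\ forall v : V, Theta (kingdon_iota B v) = theta v.
Proof.
pose h := free_lift theta; have hom_h : alg_hom h := free_lift_hom theta.
have hV v : h (free_var v) = theta v := free_lift_var theta v.
have h_rel x : kingdon_rel B x -> h x = 0.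
  case: hom_h (alg_homB hom_h) (alg_homD hom_h) (alg_homZ hom_h).
  move=> _ h1 hM hB hD hZ [[u [v ->]]|[u [v [w ->]]]].
    (* Each kind of generator is sent to the difference of the two sides of the matching hypothesis
       on [theta]. *)
    by rewrite hB hD hZ h1 !hM !hV htheta subrr.
  by rewrite hB !hM !hV htheta3 subrr.
have hI := gen_ideal_hom_ker hom_h h_rel.
exists (@quot_lift _ _ _ (gen_ideal (kingdon_rel B)) h); split.
  by split=> [|v]; [apply: quot_lift_hom | rewrite quot_liftE].
move=> g [hom_g gV]; apply/funext; apply: quot_pi_surj => x.
rewrite quot_liftE //; apply/esym.
(* [gV] applies as it stands to [g] composed with the projection, since [kingdon_iota B v] unfolds
   to the class of [free_var v]. *)
exact: (free_lift_uniq (alg_hom_comp (quot_pi_hom _) hom_g) gV).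
Qed.
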